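(* Let $0<p<1$ and consider the elephant random walk that remembers only the most recent step. Let $T_n=\sum_{k=1}^n X_k$ when the first step is fixed, either $X_1=1$ or $X_1=-1$, and let $S_n=\sum_{k=1}^n X_k$ when the first step is random with $P(X_1=1)=p=1-P(X_1=-1)$. Then, as $n\to\infty$, $$\frac{T_n}{\sqrt n}\ \text{ converges in distribution to }\ \mathcal N_{0,\frac p{1-p}}\quad\text{and}\quad\frac{S_n}{\sqrt n}\ \text{ converges in distribution to }\ \mathcal N_{0,\frac p{1-p}}.$$
   Context: Elephant random walk remembering only the most recent step: for every $n\ge1$, $X_{n+1}=X_n$ with probability $p$ and $X_{n+1}=-X_n$ with probability $1-p$, i.e. $X_{n+1}=\varepsilon_{n+1}X_n$ where $\varepsilon_2,\varepsilon_3,\dots$ are i.i.d. with $P(\varepsilon_i=1)=p=1-P(\varepsilon_i=-1)$ and independent of $X_1$. $\mathcal N_{0,\sigma^2}$ denotes the normal law with mean $0$ and variance $\sigma^2$. *)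

(* Defs.v *)
From HB Require Import structures.
From mathcomp Require Import all_boot all_order all_algebra finmap.
From mathcomp Require Import all_classical all_reals all_analysis.
From mathcomp Require Import measurable_realfun.
Import Order.TTheory GRing.Theory Num.Theory.
Import numFieldNormedType.Exports.

Set Implicit Arguments.
Unset Strict Implicit.
Unset Printing Implicit Defensive.

Local Open Scope classical_set_scope.
Local Open Scope ring_scope.

Section independence.
Context {d : measure_display} {T : measurableType d} {R : realType}
  (P : probability T R).

Definition mutually_independent {I : choiceType} (D : set I)
    (X : I -> {RV P >-> R}) :=
  forall (J : {fset I}) (B : I -> set R), [set` J] `<=` D ->
    (forall i, i \in J -> measurable (B i)) ->
    P (\bigcap_(i in [set` J]) (X i @^-1` B i)) =
    (\prod_(i <- J) P (X i @^-1` B i))%E.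

Definition sigma_family {I : Type} (D : set I) (X : I -> {RV P >-> R}) :
    set (set T) :=
  <<s [set A | exists i B, [/\ D i, measurable B & A = X i @^-1` B]] >>.

Definition independent_of_family {I : Type} (D : set I) (Y : {RV P >-> R})
    (X : I -> {RV P >-> R}) :=
  forall (B : set R) (A : set T), measurable B -> sigma_family D X A ->
    P (Y @^-1` B `&` A) = (P (Y @^-1` B) * P A)%E.

Definition sign_law (p : R) (Y : {RV P >-> R}) :=
  P (Y @^-1` [set 1]) = p%:E /\ P (Y @^-1` [set -1]) = (1 - p)%:E.

Definition cvg_in_distribution (X : nat -> {RV P >-> R})
    (mu : probability (measurableTypeR R) R) :=
  forall x : R, {for x, continuous (fun r : R => mu `]-oo, r]%classic)} ->
    cdf (X n) x @[n --> \oo] --> mu `]-oo, x]%classic.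

(* Only [X n] with [1 <= n] and [eps n] with [2 <= n] are constrained. *)
Record recent_step_walk (p : R) (X eps : nat -> {RV P >-> R}) : Prop := {
  step_law : forall n, (2 <= n)%N -> sign_law p (eps n) ;
  step_independent : mutually_independent [set n | (2 <= n)%N] eps ;
  step_independent_start :
    independent_of_family [set n | (2 <= n)%N] (X 1%N) eps ;
  step_rec : forall n, (1 <= n)%N ->
    forall w, X n.+1 w = eps n.+1 w * X n w }.

Definition partial_sum (X : nat -> {RV P >-> R}) (n : nat) : {RV P >-> R} :=
  \sum_(1 <= k < n.+1) X k.

Definition normalized_sum (X : nat -> {RV P >-> R}) (n : nat) : {RV P >-> R} :=
  (Num.sqrt n%:R)^-1 \o* partial_sum X n.

End independence.

(* Main.v *)
From HB Require Import structures.
Require Import Defs.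
From mathcomp Require Import all_boot all_order all_algebra finmap.
From mathcomp Require Import all_classical all_reals all_analysis.
From mathcomp Require Import measurable_realfun.
From mathcomp Require Import ring lra zify.
Import Order.TTheory GRing.Theory Num.Theory.
Import numFieldNormedType.Exports.
Local Open Scope classical_set_scope.
Local Open Scope ring_scope.

(* Lindeberg's method along an explicit solution of the heat equation.
   The process N_n = 2(1-p) S_n + (2p-1) X_n is a martingale, since
   N_(n+1) - N_n = X_(n+1) - (2p-1) X_n, and because X_n^2 = 1 its increments have
   the constant conditional variance v = 4p(1-p). With h = 1/sqrt n, the function
   Phi((c - h N)/sqrt w), Phi the standard normal distribution function, is a
   smoothed indicator of {h N <= c}; one step of the chain turns it into
   Phi((c - h N)/sqrt(w + v h^2)) up to an error O((h/sqrt w)^3). After n steps one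
   gets Phi(c/sqrt(w + v)) up to O(h/w^(3/2)), and then w -> 0 gives the limit
   Phi(2(1-p) y/sqrt v), the normal law of variance p/(1-p), for S_n <= y sqrt n.
   The law of S_n is tied to the transition operator by conditioning on cylinders
   {X_1 in B_1, eps_2 in B_2, ..., eps_k in B_k}. *)

(** * Taylor estimates from the mean value theorem *)

Section taylor.
Context {R : realType}.
Implicit Types (f : R -> R) (K x y : R).

(** The engine of the Taylor bounds below: each application of the mean value theorem raises the
    order by one. Constants are not sharp (no factorials), since only the order of the error matters
    later. *)
Lemma mvt_pow_bound f f' K k x y :
  (forall t : R, is_derive t (1 : R) f (f' t)) ->
  (forall t, `|t - x| <= `|y - x| -> `|f' t| <= K * `|t - x| ^+ k) ->
  `|f y - f x| <= K * `|y - x| ^+ k.+1.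
Proof.
move=> df bf.
have cf (A : set R) : {within A, continuous f}.
  apply: continuous_subspaceT => t; apply: differentiable_continuous.
  exact/derivable1_diffP/ex_derive.
suff [c cx ->] : exists2 c, `|c - x| <= `|y - x| & f y - f x = f' c * (y - x).
  rewrite normrM exprSr mulrA ler_wpM2r//.
  have K0 : 0 <= K * `|c - x| ^+ k := le_trans (normr_ge0 _) (bf _ cx).
  apply: (le_trans (bf _ cx)).
  (* The sign of [K] is read off the bound at [c], or off the bound at [y] when [c] equals [x] and
     the power vanishes. *)
  have [->|c0] := eqVneq c x.
    rewrite subrr normr0; case: k {bf K0} => [|k] in bf K0 *; first by rewrite !expr0.
    rewrite expr0n/= mulr0.
    have [->|yx] := eqVneq y x; first by rewrite subrr normr0 expr0n/= mulr0.
    rewrite mulr_ge0 ?exprn_ge0//.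
    have := le_trans (normr_ge0 _) (bf y (lexx _)).
    by rewrite pmulr_lge0// exprn_gt0// normr_gt0 subr_eq0.
  rewrite ler_wpM2l ?lerXn2r ?nnegrE//.
  by move: K0; rewrite pmulr_lge0// exprn_gt0// normr_gt0 subr_eq0.
have [xy|yx] := leP x y.
  have [c /[!in_itv]/= /andP[xc cy] e] := MVT_segment xy (fun t _ => df t) (cf _).
  exists c; rewrite // !ger0_norm ?subr_ge0// lerD2r//.
have [c /[!in_itv]/= /andP[xc cy] e] := MVT_segment (ltW yx) (fun t _ => df t) (cf _).
exists c; first by rewrite !ler0_norm ?subr_le0 ?(ltW yx)// lerN2 lerD2r.
by rewrite -opprB e -mulrN opprB.
Qed.

Lemma taylor1_bound f f1 f2 K x y :
  (forall t : R, is_derive t (1 : R) f (f1 t)) ->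
  (forall t : R, is_derive t (1 : R) f1 (f2 t)) ->
  (forall t, `|t - x| <= `|y - x| -> `|f2 t| <= K) ->
  `|f y - f x - (y - x) * f1 x| <= K * `|y - x| ^+ 2.
Proof.
move=> d0 d1 b.
pose g t := f t - t * f1 x.
have dg (t : R) : is_derive t (1 : R) g (f1 t - f1 x).
  by apply: is_derive_eq; rewrite scaler0 add0r /GRing.scale/= mulr1.
rewrite (_ : _ - _ = g y - g x); last by rewrite /g; ring.
apply: (@mvt_pow_bound g (fun t => f1 t - f1 x) K 1) => // t tx.
apply: (@mvt_pow_bound f1 f2 K 0) => // s sx.
by rewrite mulr1; apply/b/(le_trans sx).
Qed.

(** Subtracting the Taylor polynomial at [x] leaves [g], whose derivative is the first-order
    remainder of [f1]; [taylor1_bound] controls that remainder quadratically. *)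
Lemma taylor2_bound f f1 f2 f3 K x y :
  (forall t : R, is_derive t (1 : R) f (f1 t)) ->
  (forall t : R, is_derive t (1 : R) f1 (f2 t)) ->
  (forall t : R, is_derive t (1 : R) f2 (f3 t)) ->
  (forall t, `|t - x| <= `|y - x| -> `|f3 t| <= K) ->
  `|f y - f x - (y - x) * f1 x - (y - x) ^+ 2 / 2 * f2 x|
    <= K * `|y - x| ^+ 3.
Proof.
move=> d0 d1 d2 b.
pose g t := f t - t * f1 x - (t - x) ^+ 2 * (f2 x / 2).
have dg (t : R) : is_derive t (1 : R) g (f1 t - f1 x - (t - x) * f2 x).
  apply: is_derive_eq; rewrite !scaler0 !add0r /GRing.scale/= !subr0 !mulr1.
  by field.
rewrite (_ : _ - _ = g y - g x); last by rewrite /g; field.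
apply: (@mvt_pow_bound g (fun t => f1 t - f1 x - (t - x) * f2 x) K 2) => // t tx.
apply: (@taylor1_bound f1 f2 f3 K) => // s sx.
exact/b/(le_trans sx).
Qed.

End taylor.

(** * The normal distribution function and its derivatives *)

Section normal_cdf.
Context {R : realType}.
Implicit Types (s x z : R).

Definition normal_cdf s x : R := fine (normal_prob 0 s `]-oo, x]).

Local Notation Phi := (normal_cdf 1).
Local Notation phi := (normal_pdf 0 (1 : R)).

Lemma normal_cdfK s x : (normal_cdf s x)%:E = normal_prob 0 s `]-oo, x].
Proof. by rewrite /normal_cdf fineK// fin_num_measure. Qed.

Lemma normal_cdf_ge0 s x : 0 <= normal_cdf s x.
Proof. by rewrite fine_ge0. Qed.

Lemma normal_cdf_le1 s x : normal_cdf s x <= 1.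
Proof. by rewrite -lee_fin normal_cdfK probability_le1. Qed.

Lemma normal_cdf_nondecreasing s : {homo normal_cdf s : x y / x <= y}.
Proof.
move=> x y xy; rewrite -lee_fin !normal_cdfK le_measure ?inE//.
by apply: subset_itvl; rewrite bnd_simp.
Qed.

(** The identity, seen as a random variable under [normal_prob 0 s], has cdf [normal_cdf s]; the
    general limits of a cdf at both infinities then apply. *)
Let idTR : measurableTypeR R -> R := idfun.

#[local] HB.instance Definition _ :=
  @isMeasurableFun.Build _ _ _ _ idTR (@measurable_id _ _ setT).

Lemma cdf_idTR s :
  cdf (idTR : {RV (normal_prob 0 s) >-> R}) = EFin \o normal_cdf s.
Proof. by apply/funext => x; rewrite /= normal_cdfK. Qed.

Lemma cvg_normal_cdfy s : normal_cdf s x @[x --> +oo] --> (1 : R).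
Proof.
have /fine_cvg := @cvg_cdfy1 _ _ _ (normal_prob 0 s) idTR.
by rewrite cdf_idTR.
Qed.

Lemma cvg_normal_cdfNy s : normal_cdf s x @[x --> -oo] --> (0 : R).
Proof.
have /fine_cvg := @cvg_cdfNy0 _ _ _ (normal_prob 0 s) idTR.
by rewrite cdf_idTR.
Qed.

Lemma is_derive_normal_cdf s x : s != 0 ->
  is_derive x (1 : R) (normal_cdf s) (normal_pdf 0 s x).
Proof.
move=> s0.
(* [x + 1] is an arbitrary point beyond [x], making [x] interior to the domain of integration. *)
have := @continuous_FTC1 R (normal_pdf 0 s) -oo%O x (x + 1).
move=> /(_ _ _ _ _)[]//.
- by rewrite ltrDl.
- by apply: integrableS (integrable_normal_pdf 0 s).
- exact: ltNyr.
- exact: continuous_normal_pdf.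
rewrite derive1E => dF <-.
by have := derivableP dF; rewrite /Rintegral.
Qed.

Lemma normal_pdf1E x : phi x = normal_peak 1 * expR (- x ^+ 2 / 2).
Proof. by rewrite normal_pdfE ?oner_neq0// /normal_fun subr0 expr1n. Qed.

(** Both sides have the same derivative, so their difference is constant, and it tends to 0 at minus
    infinity. *)
Lemma normal_cdf_scale s x : 0 < s -> normal_cdf s x = Phi (x / s).
Proof.
move=> s0; have sN0 := lt0r_neq0 s0.
pose g y := normal_cdf s y - (Phi \o (fun y => s^-1 * y)) y.
have dPhi y := @is_derive_normal_cdf 1 y (oner_neq0 _).
have dg (y : R) : is_derive y (1 : R) g 0.
  have dF := @is_derive_normal_cdf s y sN0.
  have dl : is_derive y (1 : R) (fun y => s^-1 * y) s^-1.
    by apply: is_derive_eq; rewrite /GRing.scale/=; ring.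
  have dc := is_derive1_comp (dPhi (s^-1 * y)) dl.
  apply: is_derive_eq; apply/eqP; rewrite subr_eq0; apply/eqP.
  rewrite !normal_pdfE ?oner_neq0// /normal_peak /normal_fun !subr0 expr1n mul1r.
  rewrite -mulrnAr sqrtrM ?sqr_ge0// sqrtr_sqr gtr0_norm// invfM.
  rewrite (_ : - y ^+ 2 / (s ^+ 2 *+ 2) = - (s^-1 * y) ^+ 2 / 2); first by ring.
  by rewrite -[s ^+ 2 *+ 2]mulr_natr; field.
have g0 : g y @[y --> -oo] --> (0 : R).
  rewrite -(subr0 0); apply: cvgB; first exact: cvg_normal_cdfNy.
  apply: cvg_comp; last exact: cvg_normal_cdfNy.
  by apply: gt0_cvgMrNy; [rewrite invr_gt0|exact: cvg_id].
have gc : g y @[y --> -oo] --> g x.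
  rewrite (_ : g = cst (g x)); first exact: cvg_cst.
  by apply/funext => y; exact: is_derive_0_is_cst.
have gx0 : g x = 0 by apply: (cvg_unique _ gc g0).
by apply/eqP; rewrite -subr_eq0 (mulrC x) -gx0.
Qed.

Lemma continuous_normal_cdf1 : continuous Phi.
Proof.
move=> x; apply: differentiable_continuous; apply/derivable1_diffP.
exact/ex_derive/is_derive_normal_cdf/oner_neq0.
Qed.

Lemma is_derive_normal_pdf1 x : is_derive x (1 : R) phi (- x * phi x).
Proof.
rewrite (_ : phi = fun y => normal_peak 1 * (expR \o (fun z => - z ^+ 2 / 2)) y).
  have d2 : is_derive x (1 : R) (fun z : R => - z ^+ 2 / 2) (- x).
    by apply: is_derive_eq; rewrite /GRing.scale/=; field.
  have dc := @is_derive1_comp _ _ (fun z => - z ^+ 2 / 2) _ _ _ (is_derive_expR _) d2.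
  by apply: is_derive_eq; rewrite /GRing.scale/=; ring.
by apply/funext => y; rewrite normal_pdf1E.
Qed.

Lemma is_derive2_normal_pdf1 x :
  is_derive x (1 : R) (fun y => - y * phi y) ((x ^+ 2 - 1) * phi x).
Proof.
have d := is_derive_normal_pdf1 x.
by apply: is_derive_eq; rewrite /GRing.scale/=; ring.
Qed.

(** With t = x^2/2, the exponential of t dominates 1, t and t^2/2, and the peak is at most 1. The
    constants come from x^2 = 2t and x^4 = 8 (t^2/2). *)
Lemma normal_pdf1_bounds x :
  [/\ 0 <= phi x, phi x <= 1, x ^+ 2 * phi x <= 2 & x ^+ 4 * phi x <= 8].
Proof.
have c0 : 0 <= normal_peak (1 : R) by exact: normal_peak_ge0.
have c1 : normal_peak (1 : R) <= 1.
  have pi2 : 1 <= pi *+ 2 :> R by rewrite mulr2n; have := pi_ge2 R; lra.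
  rewrite /normal_peak expr1n mul1r invf_le1 ?sqrtr_gt0 ?(lt_le_trans ltr01 pi2)//.
  by rewrite -[leLHS]sqrtr1 ler_wsqrtr.
rewrite normal_pdf1E mulNr expRN; set c := normal_peak 1 in c0 c1 *.
set t := x ^+ 2 / 2; have t0 : 0 <= t by rewrite divr_ge0 ?sqr_ge0.
have e1 : 1 + t <= expR t := expR_ge1Dx _.
have e2 := @expR_ge1Dxn R t 1 t0.
have eN0 : expR t != 0 by rewrite gt_eqF ?expR_gt0.
have e0 : 0 <= (expR t)^-1 by rewrite invr_ge0 expR_ge0.
have xE : x ^+ 2 = 2 * t by rewrite /t; field.
have xE4 : x ^+ 4 = 4 * t ^+ 2 by rewrite (exprM x 2 2) xE; ring.
have bd q : 0 <= q -> q <= expR t -> q * (c / expR t) <= 1.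
  move=> q0 qe; rewrite mulrCA -[leRHS]mulr1 ler_pM ?mulr_ge0//.
  by rewrite ler_pdivrMr ?expR_gt0// mul1r.
split.
- by rewrite mulr_ge0.
- by have := bd 1 ler01; rewrite mul1r; apply; lra.
- by rewrite xE -mulrA; have := bd t t0; lra.
- have := bd (t ^+ 2 / 2); rewrite xE4 divr_ge0 ?sqr_ge0// => /(_ isT).
  by move: e2; rewrite (_ : 2`! = 2)// => e2 /(_ _); lra.
Qed.

End normal_cdf.

(** * One step of the heat equation *)

Section heat_step.
Context {R : realType}.
Implicit Types (p x z t d : R).

Local Notation Phi := (@normal_cdf R 1).
Local Notation phi := (normal_pdf 0 (1 : R)).

(** The third derivative of [Phi] is (t^2 - 1) phi(t), of size at most 2 + 1 by
    [normal_pdf1_bounds]. *)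
Lemma normal_cdf_taylor z d :
  `|Phi (z + d) - Phi z - d * phi z - d ^+ 2 / 2 * (- z * phi z)|
    <= 3 * `|d| ^+ 3.
Proof.
have dPhi y := @is_derive_normal_cdf R 1 y (oner_neq0 _).
have := @taylor2_bound R Phi phi (fun t => - t * phi t)
  (fun t => (t ^+ 2 - 1) * phi t) 3 z (z + d) dPhi is_derive_normal_pdf1
  is_derive2_normal_pdf1.
rewrite (addrC z) addrK; apply => t _; rewrite mulrBl mul1r.
by have [? ? ? _] := normal_pdf1_bounds t; rewrite ler_norml; apply/andP; split;
  have := mulr_ge0 (sqr_ge0 t) (normal_pdf_ge0 0 1 t); lra.
Qed.

(** The second derivative of s -> Phi(s z) is -s z^3 phi(s z). For s >= 1/2 and u = s|z|, its size
    is at most 4 u^3 phi(u) <= 2 (u^2 + u^4) phi(u) <= 20, uniformly in z. *)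
Lemma normal_cdf_shrink z t : 2^-1 <= t -> t <= 1 ->
  `|Phi (t * z) - Phi z - (t - 1) * (z * phi z)| <= 20 * (1 - t) ^+ 2.
Proof.
move=> t2 t1.
pose f s := Phi (s * z); pose f1 s := z * phi (s * z).
pose f2 s := z * (- (s * z) * phi (s * z) * z).
have dl (s : R) : is_derive s (1 : R) (fun s => s * z) z.
  by apply: is_derive_eq; rewrite /GRing.scale/=; ring.
have d0 (s : R) : is_derive s (1 : R) f (f1 s).
  have dc := @is_derive1_comp _ _ (fun s => s * z) _ _ _
    (@is_derive_normal_cdf R 1 (s * z) (oner_neq0 _)) (dl s).
  by apply: is_derive_eq; rewrite mulrC.
have d1 (s : R) : is_derive s (1 : R) f1 (f2 s).
  have dc := @is_derive1_comp _ _ (fun s => s * z) _ _ _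
    (is_derive_normal_pdf1 (s * z)) (dl s).
  have : is_derive s (1 : R) (z \*: (phi \o (fun s => s * z))) (f2 s).
    by apply: is_derive_eq; rewrite /GRing.scale.
  by [].
have := @taylor1_bound R f f1 f2 20 1 t d0 d1.
rewrite /f /f1 mul1r (_ : `|t - 1| ^+ 2 = (1 - t) ^+ 2); last first.
  by rewrite real_normK ?num_real// -sqrrN opprB.
apply => s.
rewrite (distrC t) (ger0_norm (_ : 0 <= 1 - t)) ?subr_ge0// ler_norml => /andP[s1 _].
have s2 : 2^-1 <= s by lra.
have [f0 _ b2 b4] := normal_pdf1_bounds (s * z).
set g := phi (s * z) in f0 b2 b4.
rewrite /f2 -/g (_ : z * _ = - (s * z * z ^+ 2 * g)); last by ring.
rewrite normrN normrM (ger0_norm f0) normrM (ger0_norm (sqr_ge0 z)) normrM.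
rewrite (ger0_norm (_ : 0 <= s)); last by lra.
set A := `|z|; have A0 : 0 <= A by exact: normr_ge0.
have zA : z ^+ 2 = A ^+ 2 by rewrite /A real_normK ?num_real.
rewrite zA.
have {}b2 : (s * A) ^+ 2 * g <= 2 by rewrite exprMn -zA -exprMn.
have {}b4 : (s * A) ^+ 4 * g <= 8.
  by rewrite exprMn (exprM A 2 2) -zA -exprM -exprMn.
have h1 : s * A * A ^+ 2 * g <= 4 * ((s * A) ^+ 3 * g).
  rewrite -subr_ge0 (_ : _ - _ = s * A ^+ 3 * g * (4 * s ^+ 2 - 1)); last by ring.
  by rewrite !mulr_ge0 ?exprn_ge0//; nra.
have h2 : (s * A) ^+ 3 * g <= ((s * A) ^+ 2 * g + (s * A) ^+ 4 * g) / 2.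
  by have := mulr_ge0 (mulr_ge0 (sqr_ge0 (s * A)) f0) (sqr_ge0 (s * A - 1)); lra.
lra.
Qed.

(* [Phi (z / sqrt r)] solves the heat equation in [(r, z)]; a centered two-point
   step of variance [4 p (1 - p) t ^+ 2] therefore acts on it like an increase of
   [r], up to third order in [t]. *)
Lemma heat_step p x z t : 0 < p < 1 -> `|x| = 1 -> 0 <= t ->
  `|p * Phi (z - t * (2 * (1 - p) * x)) + (1 - p) * Phi (z + t * (2 * p * x))
     - Phi (z / Num.sqrt (1 + 4 * p * (1 - p) * t ^+ 2))| <= 100 * t ^+ 3.
Proof.
move=> /andP[p0 p1] x1 t0; set e := 4 * p * (1 - p) * t ^+ 2.
have v0 : 0 <= 4 * p * (1 - p) by nra.
have v1 : 4 * p * (1 - p) <= 1 by have := sqr_ge0 (2 * p - 1); lra.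
have xx : x ^+ 2 = 1 by rewrite -real_normK ?num_real// x1 expr1n.
have e0 : 0 <= e by rewrite mulr_ge0// sqr_ge0.
have et : e <= t ^+ 2 by rewrite ler_piMl// sqr_ge0.
(* For t > 1 the claim is trivial, all values of [Phi] lying in [0, 1]. *)
have [t_gt1|t_le1] := ltP 1 t.
  have t3 : 1 <= t ^+ 3 by rewrite exprn_ege1// ltW.
  move: (normal_cdf_ge0 1 (z - t * (2 * (1 - p) * x)))
    (normal_cdf_ge0 1 (z + t * (2 * p * x)))
    (normal_cdf_ge0 1 (z / Num.sqrt (1 + e)))
    (normal_cdf_le1 1 (z - t * (2 * (1 - p) * x)))
    (normal_cdf_le1 1 (z + t * (2 * p * x)))
    (normal_cdf_le1 1 (z / Num.sqrt (1 + e))).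
  set A := normal_cdf _ _; set B := normal_cdf _ _; set C := normal_cdf _ _.
  by move=> A0 B0 C0 A1 B1 C1; rewrite ler_norml; apply/andP; split; nra.
(* The third term is Phi(l z); since e <= 1, l lies in [1/2, 1], the range of
   [normal_cdf_shrink]. *)
set l := (Num.sqrt (1 + e))^-1.
have l0 : 0 < l by rewrite invr_gt0 sqrtr_gt0; lra.
have le : l ^+ 2 * (1 + e) = 1.
  by rewrite exprVn sqr_sqrtr ?mulVf//; lra.
have t21 : t ^+ 2 <= 1 by rewrite exprn_ile1.
have l1 : l <= 1 by nra.
have l2 : 2^-1 <= l by nra.
have [f0 f1 b2 _] := normal_pdf1_bounds z.
have nE q : 0 <= q -> `|t * (2 * q * x)| = t * (2 * q).
  by move=> q0; rewrite !normrM x1 mulr1 !ger0_norm.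
rewrite (mulrC z); have := normal_cdf_shrink z l l2 l1.
have := normal_cdf_taylor z (t * (2 * p * x)).
have := normal_cdf_taylor z (- (t * (2 * (1 - p) * x))).
rewrite normrN !nE; [|lra..].
set P1 := Phi (_ - _); set P2 := Phi (_ + _); set P3 := Phi (_ * _); set P0 := Phi z.
set f := phi z in f0 f1 b2 *.
set A1 := (X in `|X| <= _); move=> B1.
set A2 := (X in `|X| <= _); move=> B2.
set A3 := (X in `|X| <= _); move=> B3.
have zf : `|z * f| <= 3 / 2.
  have z1 : `|z| <= (1 + z ^+ 2) / 2.
    have := sqr_ge0 (`|z| - 1); rewrite sqrrB real_normK ?num_real//.
    by lra.
  by rewrite normrM (ger0_norm f0); nra.
have t3 : 0 <= t ^+ 3 by rewrite exprn_ge0.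
have cub q : 0 <= q -> q <= 1 -> 3 * (t * (2 * q)) ^+ 3 <= 24 * t ^+ 3.
  move=> q0 q1; rewrite (_ : 3 * _ = 24 * t ^+ 3 * q ^+ 3); last by ring.
  by rewrite ler_piMr ?mulr_ge0// exprn_ile1.
have {}B1 : `|A1| <= 24 * t ^+ 3 by apply: le_trans B1 (cub (1 - p) _ _); lra.
have {}B2 : `|A2| <= 24 * t ^+ 3 by apply: le_trans B2 (cub p _ _); lra.
have e2 : e ^+ 2 <= t ^+ 3.
  rewrite (@le_trans _ _ ((t ^+ 2) ^+ 2))// ?lerXn2r ?nnegrE ?sqr_ge0//.
  by rewrite (_ : _ ^+ 2 = t ^+ 3 * t) ?ler_piMr//; ring.
have le1 : 1 - l <= e by nra.
have sq : (1 - l) ^+ 2 <= e ^+ 2 by rewrite lerXn2r ?nnegrE ?subr_ge0.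
set D := (l - 1 + e / 2) * (z * f); have drift : `|D| <= 3 / 2 * e ^+ 2.
  have : `|l - 1 + e / 2| <= e ^+ 2.
    (* Consequence of l^2 (1 + e) = 1; it shows that l - 1 + e/2 is of second order in e. *)
    have E : l - 1 + e / 2 = (1 - l) * e - (1 - l) ^+ 2 * (1 + e) / 2.
      apply/eqP; rewrite -subr_eq0 (_ : _ - _ = (l ^+ 2 * (1 + e) - 1) / 2).
        by rewrite le subrr mul0r.
      by field.
    have u0 : 0 <= 1 - l by lra.
    have ue : (1 - l) * e <= e ^+ 2 by rewrite expr2 ler_wpM2r.
    have e1 : e <= 1 := le_trans et t21.
    have uu : 0 <= (1 - l) ^+ 2 := sqr_ge0 _.
    have ue0 : 0 <= (1 - l) * e := mulr_ge0 u0 e0.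
    by rewrite E ler_norml; apply/andP; split; nra.
  by rewrite /D normrM => h; have := ler_pM (normr_ge0 _) (normr_ge0 _) h zf; lra.
(* The first-order terms cancel because the step is centered. The second-order ones add up to -(e/2)
   x^2 z phi(z), matching (l - 1) z phi(z) up to [D] because x^2 = 1. The errors total at most 24 +
   20 + 3/2 times t^3. *)
rewrite (_ : p * P1 + (1 - p) * P2 - P3 =
    p * A1 + (1 - p) * A2 - A3 - D - e / 2 * (x ^+ 2 - 1) * (z * f)); last first.
  by rewrite /A1 /A2 /A3 /D /e; field.
rewrite xx subrr mulr0 mul0r subr0.
apply: (le_trans (ler_normB _ _)); apply: (le_trans (lerD (ler_normB _ _) drift)).
rewrite -addrA; apply: (le_trans (lerD (ler_normD _ _) (lerD B3 (lexx _)))).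
rewrite !normrM (ger0_norm (ltW p0)) (ger0_norm (_ : 0 <= 1 - p)); last by lra.
have pB1 := ler_wpM2l (ltW p0) B1.
have pB2 : (1 - p) * `|A2| <= (1 - p) * (24 * t ^+ 3) by rewrite ler_wpM2l// subr_ge0 ltW.
lra.
Qed.

End heat_step.

(** * Iterating the transition operator *)

Section transfer_operator.
Context {R : realType}.
Variable p : R.
Hypothesis p01 : 0 < p < 1.
Implicit Types (f g : R -> R -> R) (x s h w y c d : R) (j : nat).

Let p0 : 0 <= p. Proof. by case/andP: p01 => /ltW. Qed.
Let p1 : 0 <= 1 - p. Proof. by case/andP: p01 => _ /ltW; rewrite subr_ge0. Qed.

Local Notation Phi := (@normal_cdf R 1).

(* Transition operator of the Markov chain [(X_n, S_n)]. *)
Definition step f x s := p * f x (s + x) + (1 - p) * f (- x) (s - x).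

(** [step] averages with weights p and 1 - p: it is monotone, fixes constants, and only visits
    states with |x| = 1. *)
Lemma iter_step_le f g c j x s :
  (forall x s, `|x| = 1 -> f x s <= g x s + c) -> `|x| = 1 ->
  iter j step f x s <= iter j step g x s + c.
Proof.
move=> fg; elim: j x s => [|j ih] x s x1; first exact: fg.
rewrite !iterS /step; set F := iter j step f; set G := iter j step g.
have h1 := ler_wpM2l p0 (ih x (s + x) x1).
have h2 := ler_wpM2l p1 (ih (- x) (s - x) (etrans (normrN x) x1)).
by rewrite -/F -/G in h1 h2; lra.
Qed.

Lemma step_dist f g c x s :
  (forall x s, `|x| = 1 -> `|f x s - g x s| <= c) -> `|x| = 1 ->
  `|step f x s - step g x s| <= c.
Proof.
move=> fg x1; have h1 := fg x (s + x) x1.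
have h2 := fg (- x) (s - x) (etrans (normrN x) x1).
rewrite (_ : _ - _ = p * (f x (s + x) - g x (s + x))
                   + (1 - p) * (f (- x) (s - x) - g (- x) (s - x))); last first.
  by rewrite /step; ring.
apply: (le_trans (ler_normD _ _)); rewrite !normrM (ger0_norm p0) (ger0_norm p1).
by have := ler_wpM2l p0 h1; have := ler_wpM2l p1 h2; lra.
Qed.

(* [mart X_n S_n] is a martingale whose increments have conditional variance
   [4 p (1 - p)], whatever the past. *)
Definition mart x s := 2 * (1 - p) * s + (2 * p - 1) * x.

Local Notation v := (4 * p * (1 - p)).

Let v0 : 0 <= v. Proof. by rewrite !mulr_ge0. Qed.

Definition smooth_ind c h w x s := Phi ((c - h * mart x s) / Num.sqrt w).

(** A transition moves [mart] by 2(1-p)x with probability p and by -2px with probability 1-p: these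
    are the displacements in [heat_step], taken at t = h / sqrt w. *)
Lemma step_smooth_ind c h w x s : 0 <= h -> 0 < w -> `|x| = 1 ->
  `|step (smooth_ind c h w) x s - smooth_ind c h (w + v * h ^+ 2) x s|
    <= 100 * (h / Num.sqrt w) ^+ 3.
Proof.
move=> h0 w0 x1; have sw : 0 < Num.sqrt w by rewrite sqrtr_gt0.
have swN0 := lt0r_neq0 sw.
have := @heat_step R p x ((c - h * mart x s) / Num.sqrt w) (h / Num.sqrt w) p01 x1.
move=> /(_ (divr_ge0 h0 (ltW sw))); apply: le_trans.
rewrite le_eqVlt; apply/orP; left; apply/eqP; congr `| _ |.
rewrite /step /smooth_ind; congr (_ * Phi _ + _ * Phi _ - Phi _).
- by rewrite /mart; field.
- by rewrite /mart; field.
- rewrite -[RHS]mulrA -invfM -sqrtrM ?(ltW w0)//; congr (_ / Num.sqrt _).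
  by rewrite expr_div_n sqr_sqrtr ?(ltW w0)//; field; exact: lt0r_neq0.
Qed.

(** The one-step errors add up because [step] is a contraction ([step_dist]). Since the variance
    parameter only grows along the iteration, each error is at most the one at the initial [w]. *)
Lemma iter_step_smooth_ind c h w j x s : 0 <= h -> 0 < w -> `|x| = 1 ->
  `|iter j step (smooth_ind c h w) x s
     - smooth_ind c h (w + v * (j%:R * h ^+ 2)) x s|
    <= j%:R * (100 * (h / Num.sqrt w) ^+ 3).
Proof.
move=> h0 w0; elim: j x s => [|j ih] x s x1.
  by rewrite !mul0r mulr0 addr0 subrr normr0.
set w' := w + v * (j%:R * h ^+ 2) in ih.
have ww' : w <= w' by rewrite lerDl mulr_ge0// mulr_ge0// sqr_ge0.
have w'0 : 0 < w' := lt_le_trans w0 ww'.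
rewrite (_ : w + _ = w' + v * h ^+ 2); last by rewrite /w' -[j.+1%:R]natr1; ring.
rewrite iterS; apply: (le_trans (ler_distD (step (smooth_ind c h w') x s) _ _)).
rewrite -[j.+1%:R]natr1 [leRHS]mulrDl [1 * _]mul1r lerD//; first exact: step_dist.
apply: (le_trans (step_smooth_ind _ _ _ _ _ h0 w'0 x1)); rewrite ler_wpM2l//.
rewrite lerXn2r ?nnegrE ?divr_ge0 ?sqrtr_ge0// ler_wpM2l//.
by rewrite lef_pV2 ?posrE ?sqrtr_gt0// ler_wsqrtr.
Qed.

Definition scaled_ind h y x s : R := if s * h <= y then 1 else 0.

Let mart_bound h d x s : 0 <= h -> h <= d -> `|x| = 1 ->
  `|h * mart x s - 2 * (1 - p) * (s * h)| <= d.
Proof.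
move=> h0 hd x1; rewrite (_ : _ - _ = h * ((2 * p - 1) * x)); last first.
  by rewrite /mart; ring.
rewrite !normrM x1 mulr1 (ger0_norm h0) (le_trans _ hd)// ler_piMr//.
by rewrite ler_norml; apply/andP; split; have := p0; have := p1; lra.
Qed.

(** Of the shift 2d, one d absorbs the gap between h N and 2(1-p) h S ([mart_bound]); the other
    leaves the argument of [Phi] at least d / sqrt w wherever the indicator is 1. *)
Lemma scaled_ind_le h y d w x s : 0 <= h -> h <= d -> 0 < w -> `|x| = 1 ->
  scaled_ind h y x s <=
  smooth_ind (2 * (1 - p) * y + 2 * d) h w x s + (1 - Phi (d / Num.sqrt w)).
Proof.
move=> h0 hd w0 x1; rewrite /scaled_ind /smooth_ind.
set u := (_ - h * mart x s) / _.
have := normal_cdf_ge0 1 u; have := normal_cdf_le1 1 (d / Num.sqrt w).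
case: (leP (s * h) y) => [sy|_] ? ?; last by lra.
suff : Phi (d / Num.sqrt w) <= Phi u by lra.
apply: normal_cdf_nondecreasing; rewrite ler_wpM2r ?invr_ge0 ?sqrtr_ge0//.
have := mart_bound h d x s h0 hd x1; rewrite ler_norml => /andP[_].
have : 2 * (1 - p) * (s * h) <= 2 * (1 - p) * y by rewrite ler_wpM2l// mulr_ge0.
lra.
Qed.

Lemma scaled_ind_ge h y d w x s : 0 <= h -> h <= d -> 0 < w -> `|x| = 1 ->
  smooth_ind (2 * (1 - p) * y - 2 * d) h w x s <=
  scaled_ind h y x s + Phi (- d / Num.sqrt w).
Proof.
move=> h0 hd w0 x1; rewrite /scaled_ind /smooth_ind.
set u := (_ - h * mart x s) / _.
have := normal_cdf_le1 1 u; have := normal_cdf_ge0 1 (- d / Num.sqrt w).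
case: (leP (s * h) y) => [_|ys] ? ?; first by lra.
suff : Phi u <= Phi (- d / Num.sqrt w) by lra.
apply: normal_cdf_nondecreasing; rewrite ler_wpM2r ?invr_ge0 ?sqrtr_ge0//.
have := mart_bound h d x s h0 hd x1; rewrite ler_norml => /andP[+ _].
have : 2 * (1 - p) * y <= 2 * (1 - p) * (s * h).
  by rewrite ler_wpM2l ?mulr_ge0// ltW.
lra.
Qed.

Local Notation c := (2 * (1 - p)).

Let v_gt0 : 0 < v.
Proof. by case/andP: p01 => ? ?; rewrite !mulr_gt0// subr_gt0. Qed.

(** The smoothing variance is w = d^4, so the margin d equals 1/d standard deviations: as d tends to
    0, both the smoothing and the tail terms vanish. The variance v (1 - h^2) is that of n - 1 steps
    when h^2 = 1/n. *)
Let upper y x d h :=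
  Phi ((c * y + 2 * d - h * x) / Num.sqrt (d ^+ 4 + v * (1 - h ^+ 2)))
  + (100 * (h / (d ^+ 2) ^+ 3) + (1 - Phi d^-1)).

Let lower y x d h :=
  Phi ((c * y - 2 * d - h * x) / Num.sqrt (d ^+ 4 + v * (1 - h ^+ 2)))
  - (100 * (h / (d ^+ 2) ^+ 3) + Phi (- d^-1)).

Local Notation rate n := (Num.sqrt n%:R)^-1.

Lemma iter_step_scaled_ind_bounds y x d n : `|x| = 1 -> (0 < n)%N ->
  0 < d -> rate n <= d ->
  lower y x d (rate n) <= iter n.-1 step (scaled_ind (rate n) y) x x
    <= upper y x d (rate n).
Proof.
(* From here [n] counts transitions: time n + 1 is reached from time 1, where S_1 = X_1 = x. *)
case: n => // n x1 _ d0; set h := rate n.+1 => hd /=.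
have h0 : 0 <= h by rewrite invr_ge0 sqrtr_ge0.
have nh : n.+1%:R * h ^+ 2 = 1.
  by rewrite exprVn sqr_sqrtr// mulfV// pnatr_eq0.
have nhE : n%:R * h ^+ 2 = 1 - h ^+ 2 by rewrite -[X in X - _]nh -[n.+1%:R]natr1; ring.
have d4 : 0 < d ^+ 4 by rewrite exprn_gt0.
have sd : Num.sqrt (d ^+ 4) = d ^+ 2.
  by rewrite (exprM d 2 2) sqrtr_sqr ger0_norm// sqr_ge0.
have dd : d / d ^+ 2 = d^-1 by field; exact: lt0r_neq0.
have mx : mart x x = x by rewrite /mart; ring.
(* One factor h^2 of h^3 compensates the n summands, leaving an error of order h for fixed d. *)
have err : n%:R * (100 * (h / d ^+ 2) ^+ 3) <= 100 * (h / (d ^+ 2) ^+ 3).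
  rewrite (_ : n%:R * _ = (n%:R * h ^+ 2) * (100 * (h / (d ^+ 2) ^+ 3))).
    rewrite nhE; apply: ler_piMl; last by rewrite gerBl sqr_ge0.
    by rewrite mulr_ge0// divr_ge0// exprn_ge0// sqr_ge0.
  by field; exact: lt0r_neq0.
have sm e := iter_step_smooth_ind e h (d ^+ 4) n x x h0 d4 x1.
rewrite {}nhE sd in sm.
have H e : `|iter n step (smooth_ind e h (d ^+ 4)) x x
    - Phi ((e - h * x) / Num.sqrt (d ^+ 4 + v * (1 - h ^+ 2)))|
    <= 100 * (h / (d ^+ 2) ^+ 3).
  by have := le_trans (sm e) err; rewrite {2}/smooth_ind mx.
apply/andP; split.
- have := @iter_step_le (smooth_ind (c * y - 2 * d) h (d ^+ 4)) (scaled_ind h y)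
    (Phi (- d / Num.sqrt (d ^+ 4))) n x x.
  move=> /(_ (fun x s => scaled_ind_ge h y d (d ^+ 4) x s h0 hd d4) x1).
  rewrite sd mulNr dd; have := H (c * y - 2 * d); rewrite ler_norml => /andP[+ _].
  by rewrite /lower; lra.
- have := @iter_step_le (scaled_ind h y) (smooth_ind (c * y + 2 * d) h (d ^+ 4))
    (1 - Phi (d / Num.sqrt (d ^+ 4))) n x x.
  move=> /(_ (fun x s => scaled_ind_le h y d (d ^+ 4) x s h0 hd d4) x1).
  rewrite sd dd; have := H (c * y + 2 * d); rewrite ler_norml => /andP[_].
  by rewrite /upper; lra.
Qed.

(** * Limits of the bounds, first in n, then in the smoothing parameter d *)

Let cvg_Phi_ratio {T : Type} (F : set_system T) {FF : Filter F}
  (a b : T -> R) (a0 b0 : R) : 0 < b0 ->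
  a t @[t --> F] --> a0 -> b t @[t --> F] --> b0 ->
  Phi (a t / Num.sqrt (b t)) @[t --> F] --> Phi (a0 / Num.sqrt b0).
Proof.
move=> b00 ca cb; apply: continuous_cvg; first exact: continuous_normal_cdf1.
apply: cvgM => //; apply: cvgV; first by rewrite gt_eqF// sqrtr_gt0.
by apply: continuous_cvg => //; exact: sqrt_continuous.
Qed.

Let cvg_rate : rate n @[n --> \oo] --> (0 : R).
Proof.
apply/(gtr0_cvgV0 (f := fun n => Num.sqrt n%:R)).
  by near=> n; rewrite sqrtr_gt0 ltr0n; near: n; exists 1%N.
apply/cvgryPge => A; near=> n.
rewrite (le_trans (ler_norm A))// -sqrtr_sqr ler_wsqrtr//.
by near: n; exact: nbhs_infty_ger.
Unshelve. all: by end_near. Qed.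

Let cvg_variance d : d ^+ 4 + v * (1 - rate n ^+ 2) @[n --> \oo] --> d ^+ 4 + v.
Proof.
have -> : d ^+ 4 + v = d ^+ 4 + v * (1 - 0 * 0) by ring.
apply: cvgD; first exact: cvg_cst.
apply: cvgM; first exact: cvg_cst.
apply: cvgB; first exact: cvg_cst.
exact: (cvgM cvg_rate cvg_rate).
Qed.

Let cvg_center e x : e - rate n * x @[n --> \oo] --> e.
Proof.
rewrite -[X in _ --> X]subr0 -[X in _ - X](mul0r x).
apply: cvgB; first exact: cvg_cst.
by apply: cvgM; [exact: cvg_rate|exact: cvg_cst].
Qed.

Let cvg_error d : 100 * (rate n / (d ^+ 2) ^+ 3) @[n --> \oo] --> (0 : R).
Proof.
rewrite -(mulr0 100) -[X in _ * X](mul0r ((d ^+ 2) ^+ 3)^-1).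
apply: cvgM; first exact: cvg_cst.
by apply: cvgM; [exact: cvg_rate|exact: cvg_cst].
Qed.

Let cvg_upper_n y x d : 0 < d -> upper y x d (rate n) @[n --> \oo] -->
  Phi ((c * y + 2 * d) / Num.sqrt (d ^+ 4 + v)) + (1 - Phi d^-1).
Proof.
move=> d0; apply: cvgD.
  by apply: cvg_Phi_ratio => //; rewrite addr_gt0// exprn_gt0.
rewrite -[X in _ --> X]add0r; apply: cvgD => //; exact: cvg_cst.
Qed.

Let cvg_lower_n y x d : 0 < d -> lower y x d (rate n) @[n --> \oo] -->
  Phi ((c * y - 2 * d) / Num.sqrt (d ^+ 4 + v)) - Phi (- d^-1).
Proof.
move=> d0; apply: cvgB.
  by apply: cvg_Phi_ratio => //; rewrite addr_gt0// exprn_gt0.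
rewrite -[X in _ --> X]add0r; apply: cvgD => //; exact: cvg_cst.
Qed.

Let cvg_invy : d^-1 @[d --> (0 : R)^'+] --> +oo.
Proof.
apply/(cvgrVy (f := id)); first exact: nbhs_right_gt.
by apply: cvg_at_right_filter; exact: cvg_id.
Qed.

Let cvg_drift : 2 * d @[d --> (0 : R)^'+] --> (0 : R).
Proof.
rewrite -[X in _ --> X](mulr0 2); apply: cvgM; first exact: cvg_cst.
by apply: cvg_at_right_filter; exact: cvg_id.
Qed.

Let cvg_variance0 : d ^+ 4 + v @[d --> (0 : R)^'+] --> v.
Proof.
rewrite -[X in _ --> X]add0r; apply: cvgD; last exact: cvg_cst.
rewrite [X in _ --> X](_ : 0 = 0 ^+ 4); last by rewrite expr0n.
by apply: cvg_at_right_filter; exact: exprn_continuous.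
Qed.

Let cvg_upper y : Phi ((c * y + 2 * d) / Num.sqrt (d ^+ 4 + v)) + (1 - Phi d^-1)
  @[d --> 0^'+] --> Phi (c * y / Num.sqrt v).
Proof.
rewrite -[X in _ --> X]addr0; apply: cvgD.
  apply: cvg_Phi_ratio => //; rewrite -[X in _ --> X]addr0.
  by apply: cvgD => //; exact: cvg_cst.
rewrite -[X in _ --> X](subrr 1); apply: cvgB; first exact: cvg_cst.
by apply: cvg_comp; [exact: cvg_invy|exact: cvg_normal_cdfy].
Qed.

Let cvg_lower y : Phi ((c * y - 2 * d) / Num.sqrt (d ^+ 4 + v)) - Phi (- d^-1)
  @[d --> 0^'+] --> Phi (c * y / Num.sqrt v).
Proof.
rewrite -[X in _ --> X]subr0; apply: cvgB.
  apply: cvg_Phi_ratio => //; rewrite -[X in _ --> X]subr0.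
  by apply: cvgB => //; exact: cvg_cst.
apply: cvg_comp; last exact: cvg_normal_cdfNy.
apply/cvgNry; rewrite (_ : - _ = (fun d => d^-1)); first exact: cvg_invy.
by apply/funext => d; rewrite /GRing.opp/= opprK.
Qed.

(** The order of choice matters: d is fixed first, putting the n-limits of both bounds within e/2 of
    the target; then n is taken large, depending on d. *)
Lemma cvg_iter_step_scaled_ind y x : `|x| = 1 ->
  iter n.-1 step (scaled_ind (rate n) y) x x @[n --> \oo] -->
  Phi (c * y / Num.sqrt v).
Proof.
move=> x1; set l := Phi _; apply/cvgrPdist_le => e e0.
have e2 : 0 < e / 2 by rewrite divr_gt0.
have [d [d0 du dl]] : exists d, [/\ 0 < d,
    `|l - (Phi ((c * y + 2 * d) / Num.sqrt (d ^+ 4 + v)) + (1 - Phi d^-1))| <= e / 2 &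
    `|l - (Phi ((c * y - 2 * d) / Num.sqrt (d ^+ 4 + v)) - Phi (- d^-1))| <= e / 2].
  near (0 : R)^'+ => d; exists d; split; near: d.
  - exact: nbhs_right_gt.
  - by have /cvgrPdist_le := cvg_upper y; exact.
  - by have /cvgrPdist_le := cvg_lower y; exact.
near=> n.
have /andP[Ln Un] : lower y x d (rate n) <= iter n.-1 step (scaled_ind (rate n) y) x x
    <= upper y x d (rate n).
  apply: iter_step_scaled_ind_bounds => //; first by near: n; exists 1%N.
  by near: n; exact: (cvgr_le _ cvg_rate).
have un : `|Phi ((c * y + 2 * d) / Num.sqrt (d ^+ 4 + v)) + (1 - Phi d^-1)
    - upper y x d (rate n)| <= e / 2.
  by near: n; have /cvgrPdist_le := cvg_upper_n y x d d0; exact.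
have ln : `|Phi ((c * y - 2 * d) / Num.sqrt (d ^+ 4 + v)) - Phi (- d^-1)
    - lower y x d (rate n)| <= e / 2.
  by near: n; have /cvgrPdist_le := cvg_lower_n y x d d0; exact.
move: du dl un ln; rewrite !ler_norml => /andP[? ?] /andP[? ?] /andP[? ?] /andP[? ?].
by apply/andP; split; lra.
Unshelve. all: by end_near. Qed.

End transfer_operator.

(** * Cylinder probabilities and the Markov property of the walk *)

Section walk.
Context {d : measure_display} {T : measurableType d} {R : realType}.
Variables (P : probability T R) (p : R) (X eps : nat -> {RV P >-> R}).
Hypothesis walkX : recent_step_walk p X eps.
Implicit Types (B : nat -> set R) (A : set T) (x s h y : R) (k n j : nat).

Lemma sign_law_split (Y : {RV P >-> R}) q A : sign_law q Y -> measurable A ->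
  P A = (P (A `&` Y @^-1` [set 1%R]) + P (A `&` Y @^-1` [set (-1)%R]))%E.
Proof.
move=> [Y1 YN1] mA.
have mY (a : R) : measurable (Y @^-1` [set a]) by exact: measurable_funPTI.
have disj : [disjoint Y @^-1` [set 1%R] & Y @^-1` [set (-1)%R]].
  by apply/disj_setPS => w [/= -> /eqP]; rewrite -subr_eq0 opprK -mulr2n pnatr_eq0.
set C := Y @^-1` [set 1] `|` Y @^-1` [set -1].
have mC : measurable C by exact: measurableU.
have PC : P (~` C) = 0%E.
  have PC : P C = 1%E.
    rewrite /C measureU//; last exact/disj_set2P.
    transitivity (q%:E + (1 - q)%:E)%E; last by rewrite -EFinD addrC subrK.
    by congr (_ + _)%E; [exact: Y1|exact: YN1].
  by rewrite probability_setC// PC subee.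
have mAC : measurable (A `&` ~` C) by apply: measurableI => //; exact: measurableC.
have PAC : P (A `&` ~` C) = 0%E.
  exact: (subset_measure0 mAC (measurableC mC) (@subIsetr _ _ _) PC).
have -> : P A = P (A `&` C).
  transitivity (P (A `&` C) + P (A `&` ~` C))%E; last by rewrite PAC adde0.
  rewrite -[in LHS](setIT A) -(setUv C) setIUr measureU//.
    exact: measurableI.
  by rewrite setIACA setICr setI0.
rewrite /C setIUr measureU//.
by rewrite setIACA (disj_set2P disj) setI0.
Qed.

(* [past_indices k] is the set of [i] with [2 <= i <= k]. *)
Definition past_indices k : {fset nat} := [fset i in iota 2 k.-1]%fset.

Definition cylinder k B := X 1%N @^-1` B 1%N `&`
  \bigcap_(i in [set` past_indices k]) eps i @^-1` B i.

Lemma mem_past_indices k i : (i \in past_indices k) = (1 < i <= k)%N.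
Proof. by rewrite !inE/= mem_iota; case: k => [|k]/=; lia. Qed.

Lemma measurable_cylinder k B : (forall i, measurable (B i)) ->
  measurable (cylinder k B).
Proof.
move=> mB; apply: measurableI; first exact: measurable_funPTI.
by apply: fin_bigcap_measurable => // i _; exact: measurable_funPTI.
Qed.

(** The sign constraints form an event of [sigma_family], from which the first step splits off;
    mutual independence then factors the signs. *)
Lemma prob_cylinder k B : (forall i, measurable (B i)) ->
  P (cylinder k B) = (P (X 1%N @^-1` B 1%N) *
    \prod_(i <- past_indices k) P (eps i @^-1` B i))%E.
Proof.
move=> mB; rewrite /cylinder (step_independent_start walkX)//; last first.
  apply: (@fin_bigcap_measurable _ (g_sigma_algebraType _)) => // i.
  rewrite /= mem_past_indices => /andP[i1 _]; apply: sub_sigma_algebra.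
  by exists i, (B i).
congr (_ * _)%E; apply: (step_independent walkX) => // i.
by rewrite /= mem_past_indices => /andP[].
Qed.

Lemma past_indicesS k : (0 < k)%N ->
  past_indices k.+1 = (k.+1 |` past_indices k)%fset.
Proof.
by move=> k0; apply/fsetP => i; rewrite in_fset1U !mem_past_indices; lia.
Qed.

Let upd B k x : nat -> set R := fun i => if i == k then [set x] else B i.

(** Fixing one more sign gives a cylinder again, which keeps the induction of [prob_below_cylinder]
    within this class. For k > 0 the new index differs from 1, so the constraint on [X 1] is
    untouched. *)
Lemma cylinderS k B x : (0 < k)%N ->
  cylinder k.+1 (upd B k.+1 x) = cylinder k B `&` eps k.+1 @^-1` [set x].
Proof.
move=> k0; apply/seteqP; split=> w.
  move=> [X1 E]; split; first split.
  - by move: X1; rewrite /upd/=; case: eqP => //; lia.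
  - move=> i /= ik; have := E i; rewrite /upd/= past_indicesS// in_fset1U ik orbT.
    by case: eqP => [e|_]; [move: ik; rewrite mem_past_indices; lia|exact].
  - by have := E k.+1; rewrite /upd/= eqxx past_indicesS// in_fset1U eqxx; exact.
move=> [[X1 E] ek]; split.
  by rewrite /upd/=; case: eqP => //; lia.
move=> i /=; rewrite past_indicesS// in_fset1U /upd => /orP[/eqP ->|ik].
  by rewrite eqxx.
case: eqP => [e|_]; last exact: E.
by move: ik; rewrite mem_past_indices e; lia.
Qed.

(** Independence of the next sign from the past, obtained by comparing the product formulas at k + 1
    and k. *)
Lemma prob_cylinderS k B x : (0 < k)%N -> (forall i, measurable (B i)) ->
  P (cylinder k B `&` eps k.+1 @^-1` [set x]) =
  (P (cylinder k B) * P (eps k.+1 @^-1` [set x]))%E.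
Proof.
move=> k0 mB; rewrite -cylinderS// !prob_cylinder//; last first.
  by move=> i; rewrite /upd; case: ifP.
rewrite past_indicesS// big_fsetU1/=; last by rewrite mem_past_indices; lia.
rewrite {1 2}/upd eqxx (_ : 1%N == k.+1 = false); last by lia.
rewrite -[RHS]muleA; congr (_ * _)%E; rewrite muleC; congr (_ * _)%E.
rewrite big_seq [RHS]big_seq; apply: eq_bigr => i.
by rewrite mem_past_indices /upd; case: eqP => //; lia.
Qed.

Lemma partial_sum1 w : partial_sum X 1 w = X 1%N w.
Proof. by rewrite /partial_sum big_nat1. Qed.

Lemma partial_sumS n w : (0 < n)%N ->
  partial_sum X n.+1 w = partial_sum X n w + X n.+1 w.
Proof. by move=> n0; rewrite /partial_sum big_nat_recr. Qed.

Let below h y n := [set w | partial_sum X n w * h <= y].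

Lemma measurable_below h y n : measurable (below h y n).
Proof.
rewrite (_ : below h y n = (h \o* partial_sum X n) @^-1` `]-oo, y]).
  exact: measurable_funPTI.
by apply/seteqP; split => w /=; rewrite in_itv.
Qed.

(** The Markov property in multiplicative form, meaningful also for null cylinders. The state (x, s)
    is constant on the cylinder; splitting by the next sign a leads to (a x, s + a x) on a longer
    cylinder, with one step fewer to go. *)
Lemma prob_below_cylinder h y k B j x s : (0 < k)%N ->
  (forall i, measurable (B i)) -> `|x| = 1 ->
  (forall w, cylinder k B w -> X k w = x /\ partial_sum X k w = s) ->
  P (cylinder k B `&` below h y (k + j)) =
  (P (cylinder k B) * (iter j (step p) (scaled_ind h y) x s)%:E)%E.
Proof.
elim: j k B x s => [|j ih] k B x s k0 mB x1 cylB.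
  rewrite addn0 /= /scaled_ind; case: ifPn => sy.
    rewrite mule1; congr (P _); apply: setIidl => w /cylB[_ +].
    by rewrite /below/= => ->.
  rewrite mule0 (_ : _ `&` _ = set0) ?measure0//.
  apply/seteqP; split => // w [/cylB[_ +]]; rewrite /below/= => ->.
  by rewrite (negbTE sy).
have mU a i : measurable (upd B k.+1 a i) by rewrite /upd; case: ifP.
have law := step_law walkX (k0 : (1 < k.+1)%N).
rewrite (sign_law_split _ _ _ law); last first.
  by apply: measurableI;
    [exact: measurable_cylinder|exact: measurable_below].
rewrite iterS /step; set I := iter j _ _.
have H a : `|a| = 1 ->
    P (cylinder k B `&` below h y (k + j.+1) `&` eps k.+1 @^-1` [set a])
    = (P (cylinder k B) * P (eps k.+1 @^-1` [set a]) * (I (a * x) (s + a * x))%:E)%E.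
  move=> a1; rewrite setIAC -cylinderS// addnS -addSn.
  rewrite (ih _ _ (a * x) (s + a * x))//.
  - by rewrite cylinderS// prob_cylinderS.
  - by rewrite normrM a1 x1 mulr1.
  - move=> w; rewrite cylinderS// => -[/cylB[Xx Ss] /= ea].
    by rewrite partial_sumS// (step_rec walkX)// ea Xx Ss.
rewrite !H ?normrN ?normr1// law.1 law.2 !mul1r !mulN1r.
rewrite -!muleA -muleDr ?fin_num_measure//; exact: measurable_cylinder.
Qed.

Lemma prob_below_start h y j x : `|x| = 1 ->
  P (X 1%N @^-1` [set x] `&` below h y j.+1) =
  (P (X 1%N @^-1` [set x]) * (iter j (step p) (scaled_ind h y) x x)%:E)%E.
Proof.
(* At time 1 no sign has been used yet: [past_indices 1] is empty. *)
move=> x1; have E : cylinder 1 (fun=> [set x]) = X 1%N @^-1` [set x].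
  rewrite /cylinder (_ : [set` past_indices 1] = set0) ?bigcap_set0 ?setIT//.
  by apply/seteqP; split => // i /=; rewrite mem_past_indices; lia.
rewrite -E -add1n; apply: prob_below_cylinder => // w.
by rewrite E partial_sum1.
Qed.

Lemma cdf_normalized_sumE n y :
  cdf (normalized_sum X n) y = P (below (Num.sqrt n%:R)^-1 y n).
Proof.
by rewrite /cdf /distribution /pushforward.
Qed.

End walk.

(** * The limit law and the three initial conditions *)

Section limit.
Context {R : realType} {p : R}.
Hypothesis p01 : 0 < p < 1.
Context {d : measure_display} {T : measurableType d} {P : probability T R}.
Context {X eps : nat -> {RV P >-> R}}.
Hypothesis walkX : recent_step_walk p X eps.

Let I y x n := iter n.-1 (step p) (scaled_ind (Num.sqrt n%:R)^-1 y) x x.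

(** Since 4p(1-p) = (2(1-p))^2 p/(1-p), the factor 2(1-p) that turns S into N cancels. *)
Lemma normal_prob_limitE y :
  normal_prob 0 (Num.sqrt (p / (1 - p))) `]-oo, y] =
  (normal_cdf 1 (2 * (1 - p) * y / Num.sqrt (4 * p * (1 - p))))%:E.
Proof.
case/andP: p01 => p0 p1; have q0 : 0 < 1 - p by rewrite subr_gt0.
rewrite -normal_cdfK normal_cdf_scale ?sqrtr_gt0 ?divr_gt0//; congr (normal_cdf _ _)%:E.
have -> : 4 * p * (1 - p) = (2 * (1 - p)) ^+ 2 * (p / (1 - p)).
  by field; exact: lt0r_neq0.
rewrite [Num.sqrt (_ ^+ 2 * _)]sqrtrM ?sqr_ge0// sqrtr_sqr ger0_norm ?mulr_ge0// ?ltW//.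
by field; rewrite !lt0r_neq0// sqrtr_gt0 divr_gt0.
Qed.

(** Both starting points give the same limit, hence so does any mixture. The weights (1, 0), (0, 1)
    and (p, 1 - p) cover the two fixed starts and the random one. *)
Lemma cvg_in_distribution_normalized_sum (q1 q2 : R) : q1 + q2 = 1 ->
  (forall n y, (0 < n)%N ->
    cdf (normalized_sum X n) y = (q1 * I y 1 n + q2 * I y (-1) n)%:E) ->
  cvg_in_distribution (normalized_sum X)
    (normal_prob 0 (Num.sqrt (p / (1 - p)))).
Proof.
move=> q12 cdfE y _.
set L := normal_cdf 1 (2 * (1 - p) * y / Num.sqrt (4 * p * (1 - p))).
suff : cdf (normalized_sum X n) y @[n --> \oo] --> L%:E by rewrite -normal_prob_limitE.
have IL x : `|x| = 1 -> I y x n @[n --> \oo] --> L.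
  exact: cvg_iter_step_scaled_ind.
have : (q1 * I y 1 n + q2 * I y (-1) n)%:E @[n --> \oo] --> L%:E.
  apply: cvg_EFin; first by near=> n.
  rewrite [X in _ --> X](_ : L = q1 * L + q2 * L); last first.
    by rewrite -mulrDl q12 mul1r.
  apply: cvgD; (apply: cvgM; first exact: cvg_cst).
    exact: (IL 1 (normr1 _)).
  exact: (IL (-1) (normrN1 _)).
apply: cvg_trans; apply: near_eq_cvg; near=> n; rewrite cdfE//.
by near: n; exists 1%N.
Unshelve. all: by end_near. Qed.

End limit.

(* [normal_prob] takes the standard deviation, not the variance. *)
Theorem theorem8p1 (R : realType) (p : R) (p_gt0 : 0 < p) (p_lt1 : p < 1) :
  (forall (d : measure_display) (Omega : measurableType d)
      (P : probability Omega R) (X eps : nat -> {RV P >-> R}),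
    recent_step_walk p X eps ->
    (forall w, X 1%N w = 1) \/ (forall w, X 1%N w = -1) ->
    cvg_in_distribution (normalized_sum X)
      (normal_prob 0 (Num.sqrt (p / (1 - p))))) /\
  (forall (d : measure_display) (Omega : measurableType d)
      (P : probability Omega R) (X eps : nat -> {RV P >-> R}),
    recent_step_walk p X eps ->
    sign_law p (X 1%N) ->
    cvg_in_distribution (normalized_sum X)
      (normal_prob 0 (Num.sqrt (p / (1 - p))))).
Proof.
have p01 : 0 < p < 1 by rewrite p_gt0.
split=> d Omega P X eps walkX.
(* With a fixed first step the event that [X 1] equals a is the whole space, so [prob_below_start]
   yields the cdf itself. *)
- have start a n y : `|a| = 1 -> (forall w, X 1%N w = a) -> (0 < n)%N ->
    cdf (normalized_sum X n) y =
    (iter n.-1 (step p) (scaled_ind (Num.sqrt n%:R)^-1 y) a a)%:E.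
    move=> a1 Xa; case: n => // n _; rewrite cdf_normalized_sumE.
    have XT : X 1%N @^-1` [set a] = setT.
      by apply/seteqP; split => // w _; exact: Xa.
    rewrite -[X in P X]setTI -XT (prob_below_start _ _ _ _ walkX)// XT.
    by rewrite probability_setT mul1e.
  case=> Xa.
  + apply: (cvg_in_distribution_normalized_sum p01 1 0) => [|n y n0].
      by rewrite addr0.
    by rewrite (start 1) ?normr1// mul1r mul0r addr0.
  + apply: (cvg_in_distribution_normalized_sum p01 0 1) => [|n y n0].
      by rewrite add0r.
    by rewrite (start (-1)) ?normrN1// mul1r mul0r add0r.
- move=> lawX.
  apply: (cvg_in_distribution_normalized_sum p01 p (1 - p)) => [|[//|n] y _].
    by rewrite addrC subrK.
  rewrite cdf_normalized_sumE (sign_law_split _ _ _ _ lawX); last first.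
    exact: measurable_below.
  rewrite ![_ `&` X 1%N @^-1` _]setIC !(prob_below_start _ _ _ _ walkX) ?normrN ?normr1//.
  by rewrite lawX.1 lawX.2.
Qed.
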